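(* Let $M$ and $N$ be subspaces of $\mathbb{C}^n$ in generic position. Then the pairs $(M,N)$ and $(M^{\perp},N^{\perp})$ are unitarily equivalent.
   Context: Two subspaces $M,N$ of $\mathbb{C}^n$ are in generic position if $(M\cap N)\oplus(M\cap N^{\perp})\oplus(M^{\perp}\cap N)\oplus(M^{\perp}\cap N^{\perp})=\{0\}$, i.e. all four intersections are zero. Two pairs of subspaces $(M_1,N_1)$ and $(M_2,N_2)$ of $\mathbb{C}^n$ are unitarily equivalent if there exists a unitary operator $U:\mathbb{C}^n\to\mathbb{C}^n$ such that $UM_1=M_2$ and $UN_1=N_2$. *)

(* Defs.v *)
From HB Require Import structures.
From mathcomp Require Import all_boot all_order all_algebra.
From mathcomp Require Import sesquilinear spectral complex.
From mathcomp Require Import reals.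

Set Implicit Arguments.
Unset Strict Implicit.
Unset Printing Implicit Defensive.

Import GRing.Theory Num.Theory.
Local Open Scope ring_scope.

(* Vectors of C^n are row vectors, and dotmx u v = \sum_i u_i * (v_i)^* is the
   standard Hermitian inner product, linear in its first argument. *)

Definition orthc (C : numClosedFieldType) (n : nat) (M : {vspace 'rV[C]_n}) :
  {vspace 'rV[C]_n} := orthov (@dotmx C n) M.

Definition generic_position (C : numClosedFieldType) (n : nat)
    (M N : {vspace 'rV[C]_n}) : Prop :=
  [/\ (M :&: N = 0)%VS,
      (M :&: orthc N = 0)%VS,
      (orthc M :&: N = 0)%VS
    & (orthc M :&: orthc N = 0)%VS].

Definition unitary_operator (C : numClosedFieldType) (n : nat)
    (U : 'End('rV[C]_n)) : Prop :=
  isometry (@dotmx C n) (@dotmx C n) U /\ limg U = fullv.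

Definition unitarily_equivalent (C : numClosedFieldType) (n : nat)
    (P Q : {vspace 'rV[C]_n} * {vspace 'rV[C]_n}) : Prop :=
  exists U : 'End('rV[C]_n),
    [/\ unitary_operator U, (U @: P.1 = Q.1)%VS & (U @: P.2 = Q.2)%VS].

(* Main.v *)
Require Import Defs.
From mathcomp Require Import all_boot all_order all_algebra.
From mathcomp Require Import sesquilinear spectral complex reals.

(** Let P and Q be the orthogonal projections onto M and N, and let
    D = PQ - QP.  Since P and Q are Hermitian, D is skew-Hermitian, hence
    normal; since they are idempotent, DP = (1 - P)D and DQ = (1 - Q)D
    ([commutator_intertwine]).  So D maps M into the orthogonal complement of
    M, and N into that of N.  Generic position makes D invertible
    ([commutator_unit]): D factors as (P - Q)(P + Q - 1), and a vector killed
    by one of the two factors has components in the four intersections that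
    are assumed to vanish.

    Such a D does everything but preserve the inner product, which is repaired
    by replacing D with its unitary polar part W = D / |D|.  As |D| is a
    function of the normal matrix D, an intertwining relation for D and its
    adjoint passes to W ([polar_intertwine]); the adjoint relations are free
    here because the adjoint of D is -D.  Hence WP = (1 - P)W and
    WQ = (1 - Q)W, and since W is invertible these say that W carries M and N
    exactly onto their orthogonal complements ([limg_intertwine]).

    Vectors are rows, so a matrix acts by multiplication on the right. *)

Set Implicit Arguments.
Unset Strict Implicit.
Unset Printing Implicit Defensive.

Import GRing.Theory Num.Theory.
Local Open Scope ring_scope.
Local Open Scope sesquilinear_scope.

Lemma trmxC_mul (C : numClosedFieldType) m n p
    (A : 'M[C]_(m, n)) (B : 'M[C]_(n, p)) : (A *m B)^t* = B^t* *m A^t*.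
Proof. by rewrite trmx_mul map_mxM. Qed.

(** The entrywise form of [polar_intertwine]: the two relations together force
    |x| = |y| unless a = b = 0, after which the first can be divided by this
    common modulus. *)
Lemma normalized_intertwine (C : numClosedFieldType) (x y a b : C) :
  x != 0 -> y != 0 -> x * a = b * y -> x^* * b = a * y^* ->
  x / `|x| * a = b * (y / `|y|).
Proof.
move=> x0 y0 xa xb.
have [a0|a0] := eqVneq a 0.
  move: xa; rewrite a0 !mulr0 => /esym/eqP.
  by rewrite mulf_eq0 (negPf y0) orbF => /eqP ->; rewrite mul0r.
have : `|x| ^+ 2 * a = `|y| ^+ 2 * a.
  by rewrite !normCK (mulrC x) -mulrA xa mulrA xb -mulrA [RHS]mulrC (mulrC y).
move/(mulIf a0)/eqP; rewrite eqrXn2 // => /eqP xy.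
by rewrite mulrAC xa xy mulrA.
Qed.

(** W is the unitary polar part of D.  In an orthonormal eigenbasis of D it is
    diagonal, its entries being the eigenvalues of D divided by their moduli,
    so that the intertwining relations can be compared entry by entry.  One W
    has to serve all pairs (A, B), because it is applied to both projections. *)
Lemma polar_intertwine (C : numClosedFieldType) n (D : 'M[C]_n) :
  D \is normalmx -> D \in unitmx ->
  exists2 W : 'M[C]_n, W \is unitarymx &
    forall A B : 'M[C]_n, D *m A = B *m D -> D^t* *m B = A *m D^t* ->
      W *m A = B *m W.
Proof.
move=> /orthomx_spectralP; set S := spectralmx D; set d := spectral_diag D.
have Su : S \is unitarymx by exact: spectral_unitarymx.
have Sunit := unitarymx_unit Su.
rewrite (invmx_unitary Su) => DE Dunit.
have SS : S *m S^t* = 1%:M by apply/unitarymxP.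
have SS' : S^t* *m S = 1%:M by rewrite -(invmx_unitary Su) mulVmx.
have d0 i : d 0 i != 0.
  have : diag_mx d \in unitmx.
    suff -> : diag_mx d = S *m D *m S^t*.
      by rewrite -(invmx_unitary Su) !unitmx_mul unitmx_inv Sunit Dunit.
    by rewrite DE !mulmxA SS mul1mx -mulmxA SS mulmx1.
  by rewrite unitmxE det_diag unitfE => /prodf_neq0; apply.
pose e := \row_i (d 0 i / `|d 0 i|).
(* Expression of a matrix in the eigenbasis of D. *)
pose conj (A : 'M[C]_n) := S *m A *m S^t*.
have conjK A : S^t* *m conj A *m S = A.
  by rewrite /conj !mulmxA SS' mul1mx -mulmxA SS' mulmx1.
have conj_inv A : conj (S^t* *m A *m S) = A.
  by rewrite /conj !mulmxA SS mul1mx -mulmxA SS mulmx1.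
have conjM A B : conj (A *m B) = conj A *m conj B.
  by rewrite /conj !mulmxA -(mulmxA _ (S^t*) S) SS' mulmx1.
have conjD : conj D = diag_mx d.
  by rewrite DE conj_inv.
have conjD' : conj (D^t*) = diag_mx (map_mx Num.Def.conjC d).
  by rewrite -map_diag_mx -tr_diag_mx -conjD /conj !trmxC_mul trmxCK mulmxA.
pose W := S^t* *m diag_mx e *m S; exists W.
  rewrite !mul_unitarymx ?trmxC_unitary //.
  apply/unitarymxP; rewrite tr_diag_mx map_diag_mx mulmx_diag -diag_const_mx.
  congr diag_mx; apply/rowP => i; rewrite !mxE -normCK normf_div normr_id.
  by rewrite divff ?normr_eq0 // expr1n.
move=> A B DA DB.
have conjW : conj W = diag_mx e by exact: conj_inv.
have conj_inj : injective conj by move=> X Y XY; rewrite -[X]conjK XY conjK.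
apply: conj_inj; rewrite 2!conjM conjW.
have /matrixP DA' : conj D *m conj A = conj B *m conj D by rewrite -!conjM DA.
have /matrixP DB' : conj (D^t*) *m conj B = conj A *m conj (D^t*).
  by rewrite -!conjM DB.
apply/matrixP => i j; move: (DA' i j) (DB' i j).
rewrite conjD conjD' !mul_diag_mx !mul_mx_diag !mxE.
exact: normalized_intertwine.
Qed.

(** Both sides equal A - AX.  With X a projection, this lets an intertwiner of
    X and 1 - X be used in the opposite direction too. *)
Lemma intertwine_compl (R : pzRingType) n (A X : 'M[R]_n) :
  A *m X = (1%:M - X) *m A -> A *m (1%:M - X) = X *m A.
Proof.
by move=> AX; rewrite mulmxBr AX mulmxBl mul1mx mulmx1 opprB addrC subrK.
Qed.

(** Both sides equal PQP - QP. *)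
Lemma commutator_intertwine (R : pzRingType) n (P Q : 'M[R]_n) :
  P *m P = P ->
  (P *m Q - Q *m P) *m P = (1%:M - P) *m (P *m Q - Q *m P).
Proof.
move=> PP; rewrite [RHS]mulmxBl mul1mx mulmxBl mulmxBr !mulmxA PP.
by rewrite -(mulmxA _ P P) PP opprB [RHS]addrC subrKA.
Qed.

Section Projector.
Variables (C : numClosedFieldType) (n : nat).
Implicit Type M : {vspace 'rV[C]_n}.

(** The subspace and its complement are read off P as fixed vectors and kernel,
    which turns every later membership question into a matrix identity. *)
Definition is_orthoproj (P : 'M[C]_n) M :=
  [/\ P^t* = P, P *m P = P,
      forall u, (u \in M) = (u *m P == u)
    & forall u, (u \in orthc M) = (u *m P == 0)].

Lemma mem_vspace_rows M (u : 'rV[C]_n) :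
  (u \in M) = (u <= \matrix_(i < \dim M) (vbasis M)`_i)%MS.
Proof.
apply/idP/submxP => [uM|[w ->]].
  exists (\row_i coord (vbasis M) i u).
  rewrite mulmx_sum_row {1}(coord_vbasis uM).
  by apply: eq_bigr => i _; rewrite rowK mxE.
rewrite mulmx_sum_row rpred_sum // => i _.
by rewrite rowK rpredZ // vbasis_mem // mem_nth // size_tuple.
Qed.

(** P = B^* B, where the rows of B are an orthonormal basis of M obtained by the
    Gram-Schmidt process. *)
Lemma orthoproj_exists M : exists P, is_orthoproj P M.
Proof.
pose A := \matrix_(i < \dim M) (vbasis M)`_i.
pose B := schmidt (row_base A).
have BB : B *m B^t* = 1%:M.
  by apply/unitarymxP; rewrite schmidt_unitarymx // rank_leq_col.
have BE u : (u \in M) = (u <= B)%MS.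
  by rewrite mem_vspace_rows eqmx_schmidt_free ?row_base_free // eq_row_base.
exists (B^t* *m B); split => [||u|u].
- by rewrite trmxC_mul trmxCK.
- by rewrite mulmxA -(mulmxA _ B (B^t*)) BB mulmx1.
- rewrite BE; apply/idP/eqP => [/submxP [w ->]|<-].
    by rewrite mulmxA -(mulmxA w) BB mulmx1.
  by rewrite mulmxA submxMl.
apply/mem_orthovP/eqP => [uM|uP v].
  (* uP lies in M, so it is orthogonal to u; but <uP, uP> = <u, uP>. *)
  have uPM : u *m (B^t* *m B) \in M by rewrite BE mulmxA submxMl.
  apply/eqP; rewrite -(dnorm_eq0 (@dotmx C n)); apply/eqP.
  have := uM _ uPM; rewrite -[LHS]/(dotmx _ _) dotmxE => uPu.
  rewrite -[LHS]/(dotmx _ _) dotmxE -uPu.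
  rewrite !trmxC_mul trmxCK !mulmxA.
  by rewrite -(mulmxA _ B (B^t*)) BB mulmx1.
rewrite BE => /submxP [w ->]; rewrite -[LHS]/(dotmx _ _) dotmxE trmxC_mul mulmxA.
suff -> : u *m B^t* = 0 by rewrite mul0mx mxE.
by rewrite -[LHS]mulmx1 -BB mulmxA -(mulmxA u) uP mul0mx.
Qed.

(** The relation itself gives the inclusion of the image in the complement; its
    mirror image PW = W(1 - P) shows that W^-1 = W^* sends the complement back
    into M. *)
Lemma limg_intertwine M (P W : 'M[C]_n) :
  is_orthoproj P M -> W \is unitarymx ->
  W *m P = (1%:M - P) *m W ->
  (linfun (mulmxr W) @: M = orthc M)%VS.
Proof.
move=> [_ _ memM memMo] Wu WP; have PW := esym (intertwine_compl WP).
apply/vspaceP => v; apply/memv_imgP/idP => [[u uM ->]|vM].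
  move: uM; rewrite memM memMo lfunE /= -mulmxA WP mulmxA mulmxBr mulmx1.
  by move=> /eqP ->; rewrite subrr mul0mx.
(* The preimage of v is v W^-1. *)
exists (v *m W^t*); last by rewrite lfunE /= mulmxKtV.
move: vM; rewrite memM memMo => /eqP vP.
have WW : W^t* *m W = 1%:M by rewrite -[LHS]mul1mx mulmxA mulmxKtV.
have -> : v *m W^t* *m P = v *m (W^t* *m (P *m W) *m W^t*).
  by rewrite !mulmxA mulmxtVK.
by rewrite PW !mulmxA -(mulmxA v (W^t*) W) WW mulmx1 mulmxBr vP mulmx1 subr0.
Qed.

End Projector.

(** A vector w with w(P + Q - 1) = 0 satisfies wP = w(1 - Q), a vector of M and
    of the complement of N, hence 0; then w = wQ lies in the complement of M
    and in N, hence is 0.  A vector u with u(P - Q) = 0 satisfies uP = uQ, a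
    vector of M and N, hence 0; then u lies in both complements. *)
Lemma commutator_unit (C : numClosedFieldType) n (M N : {vspace 'rV[C]_n})
    (P Q : 'M[C]_n) :
  is_orthoproj P M -> is_orthoproj Q N -> generic_position M N ->
  P *m Q - Q *m P \in unitmx.
Proof.
move=> [_ PP memM memMo] [_ QQ memN memNo] [MN MNo MoN MoNo].
have zero (X Y : {vspace 'rV[C]_n}) u :
  (X :&: Y = 0)%VS -> u \in X -> u \in Y -> u = 0.
  by move=> XY uX uY; apply/eqP; rewrite -memv0 -XY memv_cap uX.
have CS : P *m Q - Q *m P = (P - Q) *m (P + Q - 1%:M).
  rewrite mulmxBr mulmx1 mulmxDr !mulmxBl PP QQ.
  by rewrite opprB -addrA subrKA addrC subrKA.
rewrite -row_free_unit -kermx_eq0; apply/rowV0P => u /sub_kermxP.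
rewrite CS mulmxA; move wE: (u *m (P - Q)) => w wC.
have wPQ : w *m P = w - w *m Q.
  apply: (canRL (addrK _)); apply: subr0_eq.
  by move: wC; rewrite mulmxBr mulmx1 mulmxDr.
have wP : w *m P = 0.
  apply: (zero _ _ _ MNo); first by rewrite memM -mulmxA PP.
  by rewrite memNo wPQ mulmxBl -mulmxA QQ subrr.
have w0 : w = 0.
  apply: (zero _ _ _ MoN); rewrite ?memMo ?memN ?wP //.
  by move/eqP: wPQ; rewrite wP eq_sym subr_eq0 eq_sym.
have uPQ : u *m P = u *m Q by apply/eqP; rewrite -subr_eq0 -mulmxBr wE w0.
have uP : u *m P = 0.
  apply: (zero _ _ _ MN); first by rewrite memM -mulmxA PP.
  by rewrite memN uPQ -mulmxA QQ.
by apply: (zero _ _ _ MoNo); rewrite ?memMo ?memNo -?uPQ uP.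
Qed.

(** Only the spectral theorem and moduli of scalars are used, so the result
    holds over any algebraically closed field with conjugation. *)
Theorem generic_position_orthc (C : numClosedFieldType) (n : nat)
    (M N : {vspace 'rV[C]_n}) :
  generic_position M N ->
  unitarily_equivalent (M, N) (orthc M, orthc N).
Proof.
move=> gMN.
have [P hP] := orthoproj_exists M; have [Q hQ] := orthoproj_exists N.
have Dunit := commutator_unit hP hQ gMN.
have [Ph PP _ _] := hP; have [Qh QQ _ _] := hQ.
set D := _ - _ in Dunit.
have Dh : D^t* = - D.
  by rewrite /D linearB map_mxB /= !trmxC_mul Ph Qh opprB.
have [|W Wu WE] := polar_intertwine _ Dunit.
  by apply/normalmxP; rewrite Dh mulmxN mulNmx.
(* Since D^* = -D, the adjoint relation required of X is the given one read
   through complements. *)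
have WX X : D *m X = (1%:M - X) *m D -> W *m X = (1%:M - X) *m W.
  move=> DX; apply: WE => //; rewrite Dh mulNmx mulmxN; congr (- _).
  exact: intertwine_compl.
have WP : W *m P = (1%:M - P) *m W by exact/WX/commutator_intertwine.
have WQ : W *m Q = (1%:M - Q) *m W.
  (* Exchanging P and Q changes the sign of D. *)
  apply: WX; apply: oppr_inj; rewrite -mulNmx -mulmxN opprB.
  exact: commutator_intertwine.
exists (linfun (mulmxr W)); split.
- split.
    move=> u v; rewrite !lfunE /= !dotmxE trmxC_mul mulmxA mulmxtVK //.
  apply/vspaceP => v; rewrite memvf; apply/memv_imgP; exists (v *m W^t*).
    exact: memvf.
  by rewrite lfunE /= mulmxKtV.
- exact: (limg_intertwine hP Wu WP).
exact: (limg_intertwine hQ Wu WQ).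
Qed.

Theorem theorem1p9 (R : realType) (n : nat) (M N : {vspace 'rV[R[i]]_n}) :
  generic_position M N ->
  unitarily_equivalent (M, N) (orthc M, orthc N).
Proof. exact: generic_position_orthc. Qed.
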